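(* Let $n\ge 2$, let $f\in C^{3}(\mathbb{R}^{n},\mathbb{R})$ be such that $0$ is a regular value of $f$, and let $g\in C^{2}(\mathbb{R},\mathbb{R})$ satisfy $g\ge 0$ with $g(s)=0$ if and only if $s=0$. Put $U=g\circ f$ and $M=\{x\in\mathbb{R}^{n}\mid f(x)=0\}=\{x\in\mathbb{R}^{n}\mid U(x)=0\}$. Then for every $p\in M$, the point $(p,\mathbf{0})$ is a Lyapunov unstable equilibrium point of the Newtonian dynamics $\ddot{x}=-\nabla U(x)$ on $\mathbb{R}^{n}$.
   Context: The Newtonian dynamics $\ddot{x}=-\nabla U(x)$ is regarded as the first-order system $\dot{x}=v$, $\dot{v}=-\nabla U(x)$ on $\mathbb{R}^{n}\times\mathbb{R}^{n}$. Every point of $M\times\{\mathbf{0}\}$ is an equilibrium of this system. An equilibrium $(p,\mathbf{0})$ is Lyapunov stable if for every neighborhood $N$ of $(p,\mathbf{0})$ there is a neighborhood $N'$ of $(p,\mathbf{0})$ such that every solution $(x(t),\dot{x}(t))$ with $(x(0),\dot{x}(0))\in N'$ satisfies $(x(t),\dot{x}(t))\in N$ for all $t\ge 0$; it is Lyapunov unstable if it is not Lyapunov stable. *)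

(* Defs.v *)
From HB Require Import structures.
From mathcomp Require Import all_boot all_order all_algebra.
From mathcomp Require Import all_classical all_reals all_analysis.

Set Implicit Arguments.
Unset Strict Implicit.
Unset Printing Implicit Defensive.

Import Order.TTheory GRing.Theory Num.Theory.
Import numFieldNormedType.Exports.

Local Open Scope classical_set_scope.
Local Open Scope ring_scope.

(* [class_C k f]: f is of class C^k.  The condition "Df is of class C^k" is
   expressed through the evaluations x |-> Df(x) v, one for each v, which
   amounts to the same thing because V is used here only in finite
   dimension. *)
Fixpoint class_C (R : realType) (V W : normedModType R) (k : nat)
    (f : V -> W) : Prop :=
  match k with
  | 0%N => continuous f
  | k'.+1 => (forall x, differentiable f x) /\
             (forall v, class_C k' (fun x => 'D_v f x))
  end.

Definition regular_value (R : realType) (V W : normedModType R)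
    (f : V -> W) (c : W) : Prop :=
  forall x, f x = c -> set_surj [set: V] [set: W] ('d f x).

Definition gradient (R : realType) (n : nat) (U : 'rV[R]_n -> R)
    (x : 'rV[R]_n) : 'rV[R]_n :=
  \row_(i < n) 'D_(delta_mx 0 i) U x.

(* The vector field of x' = v, v' = - grad U(x) on R^n x R^n. *)
Definition newton_field (R : realType) (n : nat) (U : 'rV[R]_n -> R)
    (z : 'rV[R]_n * 'rV[R]_n) : 'rV[R]_n * 'rV[R]_n :=
  (z.2, - gradient U z.1).

(* Solutions of z' = F(z) on [0, +oo).  The values of z at negative times are
   irrelevant: the derivative at 0 is two-sided, but a solution on [0, +oo)
   with a right derivative at 0 meets this requirement once it is extended
   affinely to negative times. *)
Definition forward_solution (R : realType) (V : normedModType R)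
    (F : V -> V) (z : R -> V) : Prop :=
  forall t : R, 0 <= t -> is_derive t 1 z (F (z t)).

Definition equilibrium (R : realType) (V : normedModType R)
    (F : V -> V) (z0 : V) : Prop :=
  F z0 = 0.

Definition lyapunov_stable (R : realType) (V : normedModType R)
    (F : V -> V) (z0 : V) : Prop :=
  forall N : set V, nbhs z0 N ->
    exists2 N' : set V, nbhs z0 N' &
      forall z : R -> V, forward_solution F z -> N' (z 0) ->
        forall t : R, 0 <= t -> N (z t).

Definition lyapunov_unstable (R : realType) (V : normedModType R)
    (F : V -> V) (z0 : V) : Prop :=
  ~ lyapunov_stable F z0.

(* Main.v *)
Require Import Defs.
From HB Require Import structures.
From mathcomp Require Import all_boot all_order all_algebra.
From mathcomp Require Import all_classical all_reals all_analysis.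
From mathcomp Require Import ring lra.

Set Implicit Arguments.
Unset Strict Implicit.
Unset Printing Implicit Defensive.

Import Order.TTheory GRing.Theory Num.Theory.
Import numFieldNormedType.Exports.

Local Open Scope classical_set_scope.
Local Open Scope ring_scope.

(* At p choose i, j with i <> j and D_i f(p) <> 0.  The field with entries D_i f
   at j and - D_j f at i is tangent to the level sets of f, while the force
   - g'(f) grad f is normal to them.  Hence the momentum W = D_i f v_j - D_j f v_i
   along this field has a derivative that is quadratic in v.  Start at p with
   velocity e times the j-th basis vector: energy conservation and U >= 0 give
   |v| <= e for all times, so W keeps at least half of its initial size, of
   order e, during a time of order 1/e.  The position thus drifts by an amount
   independent of e, which excludes stability.  Since stability only speaks of
   solutions defined for all t >= 0, such a solution has to be constructed;
   the same energy bound yields it. *)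

(** * Sup norm of rows and derivatives along curves *)

Lemma mx_entry_le (R : realType) m n (A : 'M[R]_(m, n)) i j : `|A i j| <= `|A|.
Proof.
rewrite [leRHS]/Num.norm /= mx_normrE.
exact: (le_bigmax _ (fun k : 'I_m * 'I_n => `|A k.1 k.2|) (i, j)).
Qed.

Lemma mx_norm_le (R : realType) m n (A : 'M[R]_(m, n)) e :
  0 <= e -> (forall i j, `|A i j| <= e) -> `|A| <= e.
Proof.
move=> e0 Ae; rewrite [leLHS]/Num.norm /= mx_normrE.
by apply: bigmax_le => // -[i j] _; exact: Ae.
Qed.

Lemma continuous_row (R : realType) (T : topologicalType) n
    (x : T -> 'rV[R]_n) :
  (forall i, continuous (fun t => x t 0 i)) -> continuous x.
Proof.
move=> cx t; apply/cvgrPdist_le => e e0.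
near=> s; apply: mx_norm_le; first exact: ltW.
move=> i j; rewrite ord1 !mxE; move: j; near: s; apply: filter_forall => j.
exact: ((cvgrPdist_le _ _).1 (cx j t)).
Unshelve. all: by end_near. Qed.

Lemma is_derive_comp_diff (R : realType) (V W : normedModType R) (z : R -> V)
    (phi : V -> W) (t : R) (w : V) :
  is_derive t 1 z w -> differentiable phi (z t) ->
  is_derive t 1 (phi \o z) ('D_w phi (z t)).
Proof.
move=> [/derivable1_diffP dz zw] dphi.
have dc : differentiable (phi \o z) t by exact: differentiable_comp.
split; first exact/derivable1_diffP.
rewrite deriveE// diff_comp//= deriveE//; congr ('d _ _ _).
by rewrite -zw deriveE.
Qed.

Lemma derive_rowE (R : realType) n (W : normedModType R) (u : 'rV[R]_n -> W)
    (x v : 'rV[R]_n) :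
  differentiable u x ->
  'D_v u x = \sum_i v 0 i *: 'D_(delta_mx 0 i) u x.
Proof.
move=> du; rewrite deriveE// {1}[v]row_sum_delta linear_sum.
by apply: eq_bigr => i _; rewrite linearZ /= deriveE.
Qed.

Lemma is_derive_row (R : realType) n (x : R -> 'rV[R]_n) (t : R) (v : 'rV[R]_n) :
  (forall i, is_derive t 1 (fun s => x s 0 i) (v 0 i)) -> is_derive t 1 x v.
Proof.
move=> dx.
have d : derivable x t 1.
  by apply/derivable_mxP => i j; rewrite ord1; have [] := dx j.
split=> //; rewrite derive_mx//; apply/matrixP => i j; rewrite ord1 !mxE.
by have [_ <-] := dx j.
Qed.

Lemma is_derive_entry (R : realType) n (x : R -> 'rV[R]_n) (t : R) (v : 'rV[R]_n) :
  is_derive t 1 x v -> forall i, is_derive t 1 (fun s => x s 0 i) (v 0 i).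
Proof.
move=> [dx xv] i; split; first exact: ((derivable_mxP _ _ _).1 dx).
by rewrite -xv derive_mx// mxE.
Qed.

Lemma is_derive_pair (R : realType) (V W : normedModType R) (x : R -> V)
    (y : R -> W) (t : R) v w :
  is_derive t 1 x v -> is_derive t 1 y w ->
  is_derive t 1 (fun s => (x s, y s)) (v, w).
Proof.
move=> [/derivable1_diffP dx xv] [/derivable1_diffP dy yw].
have d : differentiable (fun s => (x s, y s)) t by exact: differentiable_pair.
split; first exact/derivable1_diffP.
by rewrite deriveE// diff_pair// -xv -yw !deriveE.
Qed.

Lemma is_derive_continuous (R : realType) (V : normedModType R) (z : R -> V) (t : R) w :
  is_derive t 1 z w -> {for t, continuous z}.
Proof. by move=> [/derivable1_diffP d _]; exact: differentiable_continuous. Qed.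

(** * Mean value inequalities and primitives *)

Lemma derive_ge0_le (R : realType) (f f' : R -> R) (a b : R) :
  a <= b -> {within `[a, b], continuous f} ->
  (forall x, a < x < b -> is_derive x 1 f (f' x)) ->
  (forall x, a < x < b -> 0 <= f' x) -> f a <= f b.
Proof.
rewrite le_eqVlt => /predU1P[->//|ab] cf df f'0; rewrite -subr_ge0.
have {}df x : x \in `]a, b[ -> is_derive x 1 f (f' x).
  by rewrite in_itv; exact: df.
have [x + ->] := MVT ab df cf.
rewrite in_itv /= => /andP[ax xb]; have xab : a < x < b by rewrite ax.
by rewrite mulr_ge0 ?f'0// subr_ge0 ltW.
Qed.

(** Both [F + f] and [F - f] are nondecreasing. A comparison function, rather than a constant bound,
    is what permits exponential weights later. *)
Lemma derive_norm_le (R : realType) (f f' F F' : R -> R) (a b : R) :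
  a <= b ->
  (forall x, a <= x <= b -> is_derive x 1 f (f' x)) ->
  (forall x, a <= x <= b -> is_derive x 1 F (F' x)) ->
  (forall x, a <= x <= b -> `|f' x| <= F' x) -> `|f b - f a| <= F b - F a.
Proof.
move=> ab df dF fF.
have oc x : a < x < b -> a <= x <= b by move=> /andP[? ?]; rewrite !ltW.
have cw (h h' : R -> R) : (forall x, a <= x <= b -> is_derive x 1 h (h' x)) ->
    {within `[a, b], continuous h}.
  move=> dh; apply: continuous_in_subspaceT => x; rewrite inE /= in_itv => xab.
  exact: is_derive_continuous (dh x xab).
rewrite ler_norml; apply/andP; split.
- have d x : a <= x <= b -> is_derive x 1 (f + F) (f' x + F' x).
    by move=> xab; have := df _ xab; have := dF _ xab; move=> ? ?; exact: is_deriveD.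
  have := derive_ge0_le ab (cw _ _ d) (fun x h => d x (oc x h)).
  rewrite !fctE; move=> /(_ _); suff : forall x, a < x < b -> 0 <= f' x + F' x.
    by move=> H /(_ H); lra.
  by move=> x /oc/fF; rewrite ler_norml => /andP[]; lra.
- have d x : a <= x <= b -> is_derive x 1 (F - f) (F' x - f' x).
    by move=> xab; have := df _ xab; have := dF _ xab; move=> ? ?; exact: is_deriveB.
  have := derive_ge0_le ab (cw _ _ d) (fun x h => d x (oc x h)).
  rewrite !fctE; suff : forall x, a < x < b -> 0 <= F' x - f' x.
    by move=> H /(_ H); lra.
  by move=> x /oc/fF; rewrite ler_norml => /andP[]; lra.
Qed.

Lemma exists_primitive (R : realType) (h : R -> R) : continuous h ->
  exists H : R -> R, H 0 = 0 /\ forall t : R, 0 <= t -> is_derive t 1 H (h t).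
Proof.
move=> ch.
(* The integral starts at -1 so that every [t >= 0], including 0, is interior to the interval of
   integration and the derivative there is two-sided. *)
pose F (y : R) := (\int[lebesgue_measure]_(s in `[(-1)%R, y]) h s)%R.
exists (fun y => F y - F 0); split; first by rewrite subrr.
move=> t t0.
have hint : lebesgue_measure.-integrable `[-1, t + 1]%classic (EFin \o h).
  apply: continuous_compact_integrable; first exact: segment_compact.
  exact: continuous_subspaceT.
have t1 : t < t + 1 by rewrite ltrDl.
have tN1 : -1 < t by rewrite (lt_le_trans _ t0)// ltrN10.
have [dF F'] := continuous_FTC1_closed t1 hint tN1 (ch t).
have dFt : is_derive t 1 F (h t).
  by split; [exact: dF|rewrite -derive1E].
by have := is_deriveB dFt (is_derive_cst (F 0) t 1); rewrite subr0.
Qed.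

Lemma exists_primitive_row (R : realType) n (h : R -> 'rV[R]_n) (x0 : 'rV[R]_n) :
  continuous h ->
  exists H : R -> 'rV[R]_n,
    H 0 = x0 /\ forall t : R, 0 <= t -> is_derive t 1 H (h t).
Proof.
move=> ch.
have /choice[H HE] : forall i, exists Hi : R -> R,
    Hi 0 = 0 /\ forall t : R, 0 <= t -> is_derive t 1 Hi (h t 0 i).
  move=> i; apply: exists_primitive => t.
  by apply: (@continuous_comp _ _ _ h (fun A => A 0 i)); [exact: ch|exact: coord_continuous].
exists (fun t => x0 + \row_i H i t); split.
  by apply/rowP => i; rewrite !mxE (HE i).1 addr0.
move=> t t0.
have d : is_derive t 1 (fun t => \row_i H i t) (h t).
  apply: is_derive_row => i.
  rewrite (_ : (fun _ => _) = H i); first exact: (HE i).2.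
  by apply/funext => s; rewrite mxE.
by have := is_deriveD (is_derive_cst x0 t 1) d; rewrite add0r.
Qed.

(** * Global solutions of second-order equations by weighted Picard iteration *)

Lemma continuous_posr (R : realType) : continuous (fun t : R => Num.max t 0).
Proof.
move=> t; apply: (@continuous_max R R id (fun=> 0)); last exact: cst_continuous.
exact: cvg_id.
Qed.

Lemma is_derive_exp_scale (R : realType) (c l t : R) :
  is_derive t 1 (fun s => c * expR (l * s)) (c * l * expR (l * t)).
Proof.
have d1 : is_derive t 1 (fun s : R => l * s) l.
  by have := is_deriveZ l (is_derive_id t (1 : R)); rewrite [_ *: _]mulr1.
have d2 := @is_derive1_comp R expR (fun s => l * s) t _ _ (is_derive_expR _) d1.
apply: (is_derive_eq (is_deriveZ c d2)).
by rewrite /GRing.scale/= [expR _ * l]mulrC mulrA.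
Qed.

(** Integrating [B * expR (l * s)] from 0 gains a factor [1 / l]. A large [l] thus turns integration
    into a contraction for the norm weighted by [expR (- l * t)]. *)
Lemma exp_bound_primitive (R : realType) n (D d : R -> 'rV[R]_n) (l B T : R) :
  0 < l -> 0 <= B -> D 0 = 0 ->
  (forall t : R, 0 <= t <= T -> is_derive t 1 D (d t)) ->
  (forall t, 0 <= t <= T -> `|d t| <= B * expR (l * t)) ->
  forall t, 0 <= t <= T -> `|D t| <= B / l * expR (l * t).
Proof.
move=> l0 B0 D0 dD dB t /andP[t0 tT].
have Bl0 : 0 <= B / l by rewrite divr_ge0// ltW.
apply: mx_norm_le => [|i j]; first by rewrite mulr_ge0// expR_ge0.
rewrite ord1.
have sT s : 0 <= s <= t -> 0 <= s <= T by move=> /andP[-> st]; exact: le_trans tT.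
have := @derive_norm_le R (fun s => D s 0 j) (fun s => d s 0 j)
  (fun s => B / l * expR (l * s)) (fun s => B * expR (l * s)) 0 t t0.
rewrite D0 mxE subr0 mulr0 expR0 mulr1 => H.
apply: (@le_trans _ _ (B / l * expR (l * t) - B / l)); last by rewrite gerBl.
apply: H => s st.
- exact: is_derive_entry (dD s (sT s st)) j.
- by have := is_derive_exp_scale (B / l) l s; rewrite divfK// gt_eqF.
- by apply: le_trans (dB s (sT s st)); exact: mx_entry_le.
Qed.

Lemma exists_halving_lt (R : realType) (B e : R) :
  0 <= B -> 0 < e -> exists k, B / 2 ^+ k < e.
Proof.
move=> B0 e0; exists (Num.truncn (B / e)).+1.
rewrite ltr_pdivrMr ?exprn_gt0// mulrC -ltr_pdivrMr//.
apply: lt_trans (truncnS_gt _) _.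
by rewrite -natrX ltr_nat ltn_expl.
Qed.

Lemma geometric_cauchy_dist_lim (R : realType) (u : nat -> R) (B : R) :
  0 <= B -> (forall k, `|u k.+1 - u k| <= B / 2 ^+ k) ->
  forall k, `|lim (u @ \oo) - u k| <= B * 2 / 2 ^+ k.
Proof.
move=> B0 uB.
have um k m : `|u (m + k)%N - u k| <= B * 2 / 2 ^+ k.
  (* The induction on [m] closes only with the exact partial sum of the geometric series, which is
     the full sum times [1 - 2 ^- m]. *)
  suff : `|u (m + k)%N - u k| <= B * 2 / 2 ^+ k * (1 - (2 ^+ m)^-1).
    move=> /le_trans; apply; apply: ler_piMr.
      by rewrite divr_ge0 ?mulr_ge0// exprn_ge0.
    by rewrite gerBl invr_ge0 exprn_ge0.
  elim: m => [|m IH]; first by rewrite add0n !subrr normr0 expr0 invr1 subrr mulr0.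
  rewrite addSn -(subrKA (u (m + k)%N)); apply: le_trans (ler_normD _ _) _.
  apply: le_trans (lerD (uB _) IH) _.
  rewrite exprS exprD !invfM.
  set a := (2 ^+ m)^-1; set b := (2 ^+ k)^-1.
  by rewrite le_eqVlt; apply/orP; left; apply/eqP; field.
have cu : cvg (u @ \oo).
  apply/cauchy_cvgP/cauchy_exP => e e0.
  have [k ke] := exists_halving_lt (mulr_ge0 B0 (ler0n R 2)) e0.
  exists (u k); exists k => // m /= km.
  rewrite -ball_normE /ball_ /= distrC -(subnK km).
  exact: le_lt_trans (um _ _) ke.
move=> k.
have cn : (fun m => `|u m - u k|) @ \oo --> `|lim (u @ \oo) - u k|.
  by apply: cvg_norm; apply: cvgB => //; exact: cvg_cst.
apply: (closed_cvg (fun y => y <= B * 2 / 2 ^+ k) _ _ _ cn).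
  exact: closed_le.
by exists k => // m /= km; rewrite -(subnK km).
Qed.

Lemma geometric_cauchy_dist_lim_row (R : realType) n (u : nat -> 'rV[R]_n)
    (B : R) :
  0 <= B -> (forall k, `|u k.+1 - u k| <= B / 2 ^+ k) ->
  forall k, `|\row_i lim ((fun j => u j 0 i) @ \oo) - u k| <= B * 2 / 2 ^+ k.
Proof.
move=> B0 uB k; apply: mx_norm_le => [|i' i].
  by rewrite divr_ge0 ?mulr_ge0// exprn_ge0.
rewrite ord1 !mxE; apply: (@geometric_cauchy_dist_lim _ (fun j => u j 0 i)) => //.
move=> j; apply: le_trans (uB j).
by have := mx_entry_le (u j.+1 - u j) 0 i; rewrite !mxE.
Qed.

(* The Lipschitz constant of [G t] may grow with [t]: the iterates converge in
   the weighted norm [sup |x t| exp (- l t)] on each [0, T], where [l] depends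
   on [T], so that no gluing of local solutions is needed. *)
Lemma second_order_global_solution (R : realType) n
    (G : R -> 'rV[R]_n -> 'rV[R]_n) (x0 v0 : 'rV[R]_n) :
  (forall y : R -> 'rV[R]_n, continuous y -> continuous (fun t => G t (y t))) ->
  (forall T, exists L, forall t, 0 <= t <= T ->
     forall x y, `|G t x - G t y| <= L * `|x - y|) ->
  exists x v : R -> 'rV[R]_n,
    [/\ x 0 = x0, v 0 = v0 &
        forall t : R, 0 <= t ->
          is_derive t 1 x (v t) /\ is_derive t 1 v (G t (x t))].
Proof.
move=> Gc GL; pose pos (t : R) := Num.max t 0.
have pos_ge0 t : 0 <= pos t by rewrite le_max lexx orbT.
have posE t : 0 <= t -> pos t = t by move=> t0; exact/max_idPl.
(* [X] is obtained by integrating twice the force evaluated along a given curve [y]; a solution is a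
   fixed point [X = y] on nonnegative times. *)
pose solves (y : R -> 'rV[R]_n) (X V : R -> 'rV[R]_n) :=
  [/\ X 0 = x0, V 0 = v0, forall t : R, 0 <= t -> is_derive t 1 X (V t) &
      forall t : R, 0 <= t -> is_derive t 1 V (G t (y t))].
have cpos (X X' : R -> 'rV[R]_n) :
    (forall t : R, 0 <= t -> is_derive t 1 X (X' t)) -> continuous (X \o pos).
  move=> dX t; apply: continuous_comp; first exact: continuous_posr.
  exact: is_derive_continuous (dX _ (pos_ge0 t)).
(* The pair [(0, 0)] is a dummy value for discontinuous [y], needed only to make [S] total. *)
have /choice[S HS] : forall y, exists XV : (R -> 'rV[R]_n) * (R -> 'rV[R]_n),
    continuous y -> solves y XV.1 XV.2.
  move=> y; have [cy|ncy] := pselect (continuous y); last by exists (0, 0).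
  have [V [V0 dV]] := exists_primitive_row v0 (Gc y cy).
  have [X [X0 dX]] := exists_primitive_row x0 (cpos _ _ dV).
  exists (X, V) => _; split=> // t t0.
  by have := dX t t0; rewrite /= posE.
(* Primitives are controlled at nonnegative times only; composing with [pos] freezes the curve at
   its initial value before 0, which keeps every iterate continuous on the whole line. *)
pose nxt y := (S y).1 \o pos.
have nxt_c y : continuous y -> continuous (nxt y).
  by move=> /HS[_ _ dX _]; exact: cpos dX.
pose u k := iter k nxt (fun=> x0).
have uc k : continuous (u k).
  by elim: k => [|k IH]; [exact: cst_continuous|exact: nxt_c].
(* Two integrations multiply the weighted distance by [|L| / l ^ 2]. With [l = 1 + 2 |L|] this is at
   most 1/2, since [l ^ 2 >= 4 |L|]. *)
have [lam lam_gt0 contr] : exists2 lam : R -> R, (forall T, 0 < lam T) &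
    forall T y y' X V X' V' B, 0 <= B -> solves y X V -> solves y' X' V' ->
    (forall t, 0 <= t <= T -> `|y t - y' t| <= B * expR (lam T * t)) ->
    forall t, 0 <= t <= T -> `|X t - X' t| <= B / 2 * expR (lam T * t).
  have /choice[L HL] := GL.
  pose l T := 1 + 2 * `|L T|.
  have l0 T : 0 < l T by rewrite ltr_pwDl// mulr_ge0.
  exists l => // T y y' X V X' V' B B0 [X0 V0 dX dV] [X'0 V'0 dX' dV'] yy'.
  have dG t : 0 <= t <= T ->
      `|G t (y t) - G t (y' t)| <= `|L T| * B * expR (l T * t).
    move=> tT; apply: le_trans (HL T t tT _ _) _.
    apply: le_trans (ler_wpM2r (normr_ge0 _) (ler_norm (L T))) _.
    by rewrite -mulrA ler_wpM2l// yy'.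
  have dVV : forall t, 0 <= t <= T ->
      `|V t - V' t| <= `|L T| * B / l T * expR (l T * t).
    apply: (exp_bound_primitive _ _ _ _ dG) => //.
    - by rewrite mulr_ge0.
    - by rewrite V0 V'0 subrr.
    - by move=> t /andP[t0 _]; exact: is_deriveB (dV t t0) (dV' t t0).
  have dXX : forall t, 0 <= t <= T ->
      `|X t - X' t| <= `|L T| * B / l T / l T * expR (l T * t).
    apply: (exp_bound_primitive _ _ _ _ dVV) => //.
    - by rewrite divr_ge0 ?mulr_ge0// ltW.
    - by rewrite X0 X'0 subrr.
    - by move=> t /andP[t0 _]; exact: is_deriveB (dX t t0) (dX' t t0).
  move=> t tT; apply: le_trans (dXX t tT) _; rewrite ler_wpM2r ?expR_ge0//.
  rewrite (_ : _ / l T = B * (`|L T| / (l T * l T))); last by rewrite invfM; ring.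
  rewrite ler_wpM2l// ler_pdivrMr ?mulr_gt0// /l.
  by have := normr_ge0 (L T); have := sqr_ge0 `|L T|; lra.
have uS k : solves (u k) (S (u k)).1 (S (u k)).2 by exact: HS.
have step T : exists2 A, 0 <= A & forall k t, t <= T ->
    `|u k.+1 t - u k t| <= A / 2 ^+ k.
  have T0 := pos_ge0 T.
  (* The constant for the geometric decay is the maximum over [[0, pos T]] of the distance between
     the first two iterates. *)
  have [|c _ cmax] := @EVT_max R (fun t => `|u 1%N t - u 0%N t|) 0 (pos T) T0.
    apply: continuous_subspaceT => t; apply: cvg_norm.
    by apply: cvgB; [exact: uc|exact: cvg_cst].
  set A := `|_| in cmax.
  have H k t : 0 <= t <= pos T ->
      `|u k.+1 t - u k t| <= A / 2 ^+ k * expR (lam (pos T) * t).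
    elim: k t => [|k IH] t tT.
      rewrite expr0 divr1 (@le_trans _ _ A)//; first by apply: cmax; rewrite in_itv.
      rewrite ler_peMr// ?normr_ge0// -expR0 ler_expR mulr_ge0//; first exact/ltW.
      by case/andP: tT.
    have := contr _ _ _ _ _ _ _ (A / 2 ^+ k) _ (uS k.+1) (uS k) IH t tT.
    rewrite divr_ge0 ?exprn_ge0//; last exact: normr_ge0.
    move=> /(_ isT).
    rewrite (_ : A / 2 ^+ k / 2 = A / 2 ^+ k.+1); last first.
      by rewrite exprSr invfM mulrA.
    apply: le_trans.
    by case/andP: tT => t0 _; rewrite /u !iterS /nxt /= posE.
  exists (A * expR (lam (pos T) * pos T)).
    by rewrite mulr_ge0 ?expR_ge0// normr_ge0.
  move=> k t tT.
  (* All iterates are constant on negative times, so the bound on [[0, pos T]] extends to every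
     [t <= T]. *)
  have uE j : u j t = u j (pos t).
    by case: j => //= j; rewrite /nxt /= (posE (pos t)).
  have pT : 0 <= pos t <= pos T.
    by rewrite pos_ge0 /pos ge_max le_max tT le_max lexx orbT.
  rewrite !uE; apply: le_trans (H k _ pT) _; rewrite mulrAC; apply: ler_wpM2r.
    by rewrite invr_ge0 exprn_ge0.
  apply: ler_wpM2l; first exact: normr_ge0.
  rewrite ler_expR; apply: ler_wpM2l; first exact/ltW.
  by case/andP: pT.
pose y t := \row_i lim ((fun k => u k t 0 i) @ \oo).
have yu (T : R) : exists2 B, 0 <= B & forall k (t : R), t <= T -> `|y t - u k t| <= B / 2 ^+ k.
  have [A A0 HA] := step T; exists (A * 2); first by rewrite mulr_ge0.
  move=> k t tT.
  have := @geometric_cauchy_dist_lim_row R n (fun k => u k t) A A0.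
  by apply => j; exact: HA.
(* Convergence is uniform on all times up to [t + 1], a neighborhood of [t], so the usual argument
   with three thirds of [e] applies. *)
have yc : continuous y.
  move=> t; apply/cvgrPdist_le => e e0.
  have [B B0 HB] := yu (t + 1).
  have e30 : 0 < e / 3 by rewrite divr_gt0.
  have [k kB] := exists_halving_lt B0 e30.
  near=> s.
  have st : s <= t + 1.
    by apply: ltW; near: s; apply: lt_nbhsl; rewrite ltrDl.
  have d1 := HB k t _; have d2 := HB k s st.
  have d3 : `|u k t - u k s| <= e / 3.
    by near: s; exact: ((cvgrPdist_le _ _).1 (uc k t)).
  rewrite -(subrKA (u k t)) -(subrKA (u k s) (u k t)) addrA.
  apply: le_trans (ler_normD _ _) _; apply: le_trans (lerD (ler_normD _ _) (lexx _)) _.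
  have {}d1 : `|y t - u k t| <= B / 2 ^+ k by apply: d1; rewrite lerDl.
  rewrite distrC in d2; lra.
exists (S y).1, (S y).2; have [X0 V0 dX dV] := HS y yc.
split=> // t t0; split; first exact: dX.
suff -> : (S y).1 t = y t by exact: dV.
have [B B0 HB] := yu t.
(* Both points are compared with [u k.+1 t]: it is close to [y t] by convergence, and to [(S y).1 t]
   because [S] contracts the distance from [u k] to [y]. *)
have yX k : `|y t - (S y).1 t| <= (B + B * expR (lam t * t)) / 2 ^+ k.
  have yuk s : 0 <= s <= t -> `|u k s - y s| <= B / 2 ^+ k * expR (lam t * s).
    move=> /andP[s0 st]; rewrite distrC; apply: le_trans (HB k s st) _.
    rewrite ler_peMr ?divr_ge0 ?exprn_ge0// -expR0 ler_expR mulr_ge0//; exact: ltW.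
  have tt : 0 <= t <= t by rewrite t0 lexx.
  have B2 : 0 <= B / 2 ^+ k by rewrite divr_ge0// exprn_ge0.
  have := contr t _ _ _ _ _ _ _ B2 (uS k) (HS y yc) yuk t tt.
  have := HB k.+1 t (lexx _); rewrite {1}/u iterS /nxt /= posE//.
  move=> d1 d2; rewrite -(subrKA ((S (u k)).1 t)).
  apply: le_trans (ler_normD _ _) _; apply: le_trans (lerD d1 d2) _.
  rewrite exprSr invfM mulrDl.
  have E0 : 0 <= expR (lam t * t) by exact: expR_ge0.
  rewrite (_ : B * expR _ / _ = B / 2 ^+ k * expR (lam t * t)); last by ring.
  rewrite mulrA; set b := B / _ in B2 *.
  have := mulr_ge0 B2 E0; lra.
apply/eqP; rewrite eq_sym -subr_eq0 -normr_eq0 eq_le normr_ge0 andbT.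
rewrite leNgt; apply/negP => e0.
have BE0 : 0 <= B + B * expR (lam t * t).
  by rewrite addr_ge0// mulr_ge0// expR_ge0.
have [k] := exists_halving_lt BE0 e0.
by apply/negP; rewrite -leNgt.
Unshelve. all: by end_near. Qed.

(** * Products and compositions of functions of class C^1 and C^2 *)

Lemma class_CS (R : realType) (V W : normedModType R) k (u : V -> W) :
  class_C k.+1 u -> class_C k u.
Proof.
elim: k u => [|k IH] u [du Du]; last by split=> // v; exact/IH/Du.
by move=> x; exact: differentiable_continuous.
Qed.

Lemma derive_comp_scalar (R : realType) (V : normedModType R) (u : V -> R)
    (h : R -> R) (x v : V) :
  differentiable u x -> differentiable h (u x) ->
  'D_v (h \o u) x = 'D_v u x * 'D_1 h (u x).
Proof.
move=> du dh.
rewrite deriveE; last exact: differentiable_comp.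
rewrite diff_comp//= -(deriveE v du) -[X in 'd h _ X]mulr1.
by rewrite [X in 'd h _ X]/('D_v u x *: 1) linearZ/= -deriveE.
Qed.

Lemma class_C1_comp (R : realType) (V : normedModType R) (u : V -> R)
    (h : R -> R) : class_C 1 u -> class_C 1 h -> class_C 1 (h \o u).
Proof.
move=> [du cu] [dh ch]; split=> [x|v]; first exact: differentiable_comp.
rewrite (_ : (fun x => _) = fun x => 'D_v u x * 'D_1 h (u x)); last first.
  by apply/funext => x; exact: derive_comp_scalar.
move=> x; apply: cvgM; first exact: cu.
apply: (@continuous_comp _ _ _ u ('D_1 h)); last exact: ch.
exact: differentiable_continuous.
Qed.

Lemma class_C1_mul (R : realType) (V : normedModType R) (u w : V -> R) :
  class_C 1 u -> class_C 1 w -> class_C 1 (u * w).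
Proof.
move=> [du cu] [dw cw]; split=> [x|v]; first exact: differentiableM.
rewrite (_ : (fun x => _) = fun x => u x * 'D_v w x + w x * 'D_v u x); last first.
  by apply/funext => x; rewrite deriveM//; exact: diff_derivable.
move=> x; apply: cvgD; apply: cvgM; [|exact: cw| |exact: cu].
  exact: (differentiable_continuous (du x)).
exact: (differentiable_continuous (dw x)).
Qed.

Lemma class_C2_comp (R : realType) (V : normedModType R) (u : V -> R)
    (h : R -> R) : class_C 2 u -> class_C 2 h -> class_C 2 (h \o u).
Proof.
move=> Cu Ch; have [du Du] := Cu; have [dh Dh] := Ch.
split=> [x|v]; first exact: differentiable_comp.
rewrite (_ : (fun x => _) = 'D_v u * ('D_1 h \o u)); last first.
  by apply/funext => x; exact: derive_comp_scalar.
by apply: class_C1_mul; [exact: Du|apply: class_C1_comp; [exact: class_CS|exact: Dh]].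
Qed.

(** * Lipschitz bounds on balls *)

Lemma compact_norm_ball (R : realType) n (r : R) :
  compact [set x : 'rV[R]_n | `|x| <= r].
Proof.
apply: bounded_closed_compact.
  by exists r; split; [exact: num_real|move=> s rs x /= /le_trans; apply; exact: ltW].
apply: (@preimage_closed _ _ (fun x : 'rV[R]_n => `|x|) [set y | y <= r]).
  by move=> x _; exact: norm_continuous.
exact: closed_le.
Qed.

Lemma continuous_bounded_on_ball (R : realType) n (u : 'rV[R]_n -> R) (r : R) :
  continuous u -> exists2 K, 0 <= K & forall x, `|x| <= r -> `|u x| <= K.
Proof.
move=> cu.
have /compact_bounded[M [_ HM]] : compact (u @` [set x : 'rV[R]_n | `|x| <= r]).
  by apply: continuous_compact; [exact: continuous_subspaceT|exact: compact_norm_ball].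
exists (`|M| + 1) => [|x xr]; first by rewrite addr_ge0.
apply: (HM (`|M| + 1)); last by exists x.
by rewrite (le_lt_trans (ler_norm M))// ltrDl.
Qed.

(** The segment from [y] to [x] stays in the ball by convexity, and the partial derivatives are
    bounded there by compactness. Their bounds are summed because [|x - y|] is the sup norm. *)
Lemma class_C1_lipschitz_on_ball (R : realType) n (u : 'rV[R]_n -> R) (r : R) :
  class_C 1 u -> exists2 L, 0 <= L &
    forall x y, `|x| <= r -> `|y| <= r -> `|u x - u y| <= L * `|x - y|.
Proof.
move=> [du cu].
have /choice[K HK] : forall i : 'I_n, exists Ki : R, 0 <= Ki /\
    forall x, `|x| <= r -> `|'D_(delta_mx 0 i) u x| <= Ki.
  move=> i; have [K K0 HK] := continuous_bounded_on_ball r (cu (delta_mx 0 i)).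
  by exists K.
exists (\sum_i K i); first by apply: sumr_ge0 => i _; exact: (HK i).1.
move=> x y xr yr; set C := \sum_i K i.
pose seg (s : R) := y + s *: (x - y).
have dseg (s : R) : is_derive s 1 seg (x - y).
  have d : is_derive s 1 (fun s : R => s *: (x - y)) (x - y).
    apply: is_derive_row => i.
    rewrite (_ : (fun _ => _) = (fun s : R => (x - y) 0 i * s)).
      have := is_deriveZ ((x - y) 0 i) (is_derive_id s (1 : R)).
      by rewrite [_ *: 1]mulr1.
    by apply/funext => z; rewrite mxE mulrC.
  by have := is_deriveD (is_derive_cst y s 1) d; rewrite add0r.
have seg_r s : 0 <= s <= 1 -> `|seg s| <= r.
  move=> /andP[s0 s1].
  have -> : seg s = (1 - s) *: y + s *: x.
    by rewrite /seg scalerBr scalerBl scale1r -addrA [- _ + _]addrC.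
  apply: le_trans (ler_normD _ _) _; rewrite !normrZ ger0_norm ?subr_ge0// (ger0_norm s0).
  have xs : s * `|x| <= s * r by rewrite ler_wpM2l.
  have ys : (1 - s) * `|y| <= (1 - s) * r by rewrite ler_wpM2l// subr_ge0.
  lra.
have seg0 : seg 0 = y by rewrite /seg scale0r addr0.
have seg1 : seg 1 = x by rewrite /seg scale1r addrC subrK.
have := @derive_norm_le R (u \o seg) (fun s => 'D_(x - y) u (seg s))
  (fun s => C * `|x - y| * s) (fun=> C * `|x - y|) 0 1 ler01.
rewrite /= seg0 seg1 mulr0 mulr1 subr0; apply.
- by move=> s _; exact: is_derive_comp_diff (dseg s) (du _).
- move=> s _; have := is_deriveZ (C * `|x - y|) (is_derive_id s (1 : R)).
  by rewrite [_ *: 1]mulr1.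
- move=> s s01; rewrite derive_rowE// mulr_suml.
  apply: le_trans (ler_norm_sum _ _ _) _; apply: ler_sum => i _.
  rewrite normrM mulrC; apply: ler_pM => //; first exact/(HK i).2/seg_r.
  exact: mx_entry_le.
Qed.

Lemma gradient_lipschitz_on_ball (R : realType) n (U : 'rV[R]_n -> R) (r : R) :
  class_C 2 U -> exists2 L, 0 <= L & forall x y, `|x| <= r -> `|y| <= r ->
    `|gradient U x - gradient U y| <= L * `|x - y|.
Proof.
move=> [_ CU].
have /choice[L HL] : forall i : 'I_n, exists Li : R, 0 <= Li /\
    forall x y, `|x| <= r -> `|y| <= r ->
    `|'D_(delta_mx 0 i) U x - 'D_(delta_mx 0 i) U y| <= Li * `|x - y|.
  move=> i; have [L L0 HL] := class_C1_lipschitz_on_ball r (CU (delta_mx 0 i)).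
  by exists L.
have S0 : 0 <= \sum_i L i by apply: sumr_ge0 => i _; exact: (HL i).1.
exists (\sum_i L i) => // x y xr yr; apply: mx_norm_le; first by rewrite mulr_ge0.
move=> j i; rewrite !mxE; apply: le_trans ((HL i).2 x y xr yr) _.
rewrite ler_wpM2r// (bigD1 i)//= lerDl; apply: sumr_ge0 => k _; exact: (HL k).1.
Qed.

Lemma gradient_continuous (R : realType) n (U : 'rV[R]_n -> R) :
  class_C 2 U -> continuous (gradient U).
Proof.
move=> [_ CU]; apply: continuous_row => i.
rewrite (_ : (fun _ => _) = 'D_(delta_mx 0 i) U).
  exact: (@class_CS _ _ _ 0 _ (CU (delta_mx 0 i))).
by apply/funext => x; rewrite mxE.
Qed.

(** * Truncation to a ball *)

(** For the sup norm and [0 <= r], clamping each coordinate is a retraction onto the ball of radius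
    [r] that does not increase distances. *)
Definition clip (R : realType) n (r : R) (x : 'rV[R]_n) : 'rV[R]_n :=
  \row_i Num.max (- r) (Num.min r (x 0 i)).

Lemma clip_id (R : realType) n (r : R) (x : 'rV[R]_n) : `|x| <= r -> clip r x = x.
Proof.
move=> xr; apply/rowP => i; rewrite mxE.
have := le_trans (mx_entry_le x 0 i) xr; rewrite ler_norml => /andP[lx xu].
by rewrite min_r// max_r.
Qed.

Lemma clip_norm (R : realType) n (r : R) (x : 'rV[R]_n) :
  0 <= r -> `|clip r x| <= r.
Proof.
move=> r0; apply: mx_norm_le => // j i; rewrite !mxE ler_norml.
by rewrite le_max lexx ge_max ge_min lexx !andbT; lra.
Qed.

Lemma clip_lipschitz (R : realType) n (r : R) (x y : 'rV[R]_n) :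
  `|clip r x - clip r y| <= `|x - y|.
Proof.
apply: mx_norm_le => // j i; rewrite !mxE.
apply: le_trans (mx_entry_le _ 0 i); rewrite !mxE.
have H (a b : R) : `|Num.max (- r) (Num.min r a) - Num.max (- r) (Num.min r b)| <= `|a - b|.
  wlog ab : a b / a <= b.
    by move=> H; case: (leP a b) => [/H//|/ltW/H]; rewrite distrC [leRHS]distrC.
  rewrite distrC [leRHS]distrC (ger0_norm (x := b - a)) ?subr_ge0// ler_norml.
  case: (leP r a) => h1; case: (leP r b) => h2.
  - by case: (leP (- r) r) => h3; lra.
  - by case: (leP (- r) r) => h3; case: (leP (- r) b) => h4; lra.
  - by case: (leP (- r) r) => h3; case: (leP (- r) a) => h4; lra.
  - by case: (leP (- r) a) => h3; case: (leP (- r) b) => h4; lra.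
exact: H.
Qed.

Lemma clip_continuous (R : realType) n (r : R -> R) (y : R -> 'rV[R]_n) :
  continuous r -> continuous y -> continuous (fun t => clip (r t) (y t)).
Proof.
move=> cr cy; apply: continuous_row => i t.
rewrite (_ : (fun _ => _) = (fun t => Num.max (- r t) (Num.min (r t) (y t 0 i)))).
  apply: (@continuous_max R R (fun t => - r t) (fun t => Num.min (r t) (y t 0 i))).
    by apply: cvgN; exact: cr.
  apply: (@continuous_min R R r (fun t => y t 0 i)); first exact: cr.
  apply: (@continuous_comp _ _ _ y (fun A => A 0 i)); first exact: cy.
  exact: coord_continuous.
by apply/funext => s; rewrite mxE.
Qed.

(** * Energy conservation and global Newtonian motions *)

(** Twice the mechanical energy. The kinetic part uses the Euclidean square of the velocity, whereas
    the norm [|v|] elsewhere is the sup norm. *)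
Definition energy (R : realType) n (U : 'rV[R]_n -> R) (x v : 'rV[R]_n) : R :=
  \sum_i v 0 i ^+ 2 + 2 * U x.

(** The acceleration [w] is left arbitrary so that the formula also covers motions under a truncated
    force; it vanishes when [w] is the Newtonian force. *)
Lemma energy_is_derive (R : realType) n (U : 'rV[R]_n -> R)
    (x v : R -> 'rV[R]_n) (t : R) (w : 'rV[R]_n) :
  differentiable U (x t) -> is_derive t 1 x (v t) -> is_derive t 1 v w ->
  is_derive t 1 (fun s => energy U (x s) (v s))
    (2 * \sum_i v t 0 i * (w + gradient U (x t)) 0 i).
Proof.
move=> dU dx dv.
have dsq i : is_derive t 1 (fun s => v s 0 i ^+ 2) (2 * (v t 0 i * w 0 i)).
  apply: (is_derive_eq (is_deriveX 2 (is_derive_entry dv i))).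
  by rewrite /GRing.scale/= mulrA.
have d1 := is_derive_sum dsq.
have d2 := is_deriveZ 2 (is_derive_comp_diff dx dU).
have := is_deriveD d1 d2.
rewrite (_ : _ + _ = fun s => energy U (x s) (v s)); last first.
  by apply/funext => s; rewrite /energy !fctE fct_sumE.
move=> d; apply: (is_derive_eq d); rewrite derive_rowE// -mulr_sumr.
rewrite /GRing.scale/= -mulrDr -big_split/=; congr (_ * _).
by apply: eq_bigr => i _; rewrite !mxE mulrDr.
Qed.

(** The force is required to be Newtonian only strictly before [t]: a first-exit argument provides
    no more. Continuity carries the conservation to [t] itself. *)
Lemma energy_conserved (R : realType) n (U : 'rV[R]_n -> R)
    (x v w : R -> 'rV[R]_n) (t : R) :
  0 <= t -> (forall y, differentiable U y) ->
  (forall s : R, 0 <= s -> is_derive s 1 x (v s)) ->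
  (forall s : R, 0 <= s -> is_derive s 1 v (w s)) ->
  (forall s : R, 0 <= s < t -> w s = - gradient U (x s)) ->
  energy U (x t) (v t) = energy U (x 0) (v 0).
Proof.
move=> t0 dU dx dv wE; pose E s := energy U (x s) (v s).
have dE (s : R) (s0 : 0 <= s) := energy_is_derive (dU (x s)) (dx s s0) (dv s s0).
have Ec : {within `[0, t], continuous E}.
  apply: continuous_in_subspaceT => s; rewrite inE /= in_itv /= => /andP[s0 _].
  exact: is_derive_continuous (dE s s0).
have dE0 (s : R) : 0 < s < t -> is_derive s 1 E 0.
  move=> /andP[s0 st]; apply: (is_derive_eq (dE s (ltW s0))).
  rewrite wE ?ltW//= addNr big1 ?mulr0// => i _; by rewrite mxE mulr0.
apply/eqP; rewrite eq_le; apply/andP; split; rewrite -/(E _) -/(E 0).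
  rewrite -lerN2; apply: (@derive_ge0_le R (- E) (fun=> - 0)) => //.
  - by move=> s; apply: cvgN; exact: Ec.
  - by move=> s st; have := dE0 s st; move=> ?; exact: is_deriveN.
by apply: (@derive_ge0_le R E (fun=> 0)).
Qed.

(** At the infimum of the times where [0 <= m], all earlier values are negative, so the hypothesis
    makes [m] negative there and, by continuity, nearby. But times with [0 <= m] lie arbitrarily
    close to the infimum. *)
Lemma first_exit (R : realType) (m : R -> R) :
  (forall t : R, 0 <= t -> {for t, continuous m}) ->
  (forall t, 0 <= t -> (forall s, 0 <= s < t -> m s < 0) -> m t < 0) ->
  forall t, 0 <= t -> m t < 0.
Proof.
move=> mc mlt t t0; rewrite ltNge; apply/negP => mt.
pose A := [set s | 0 <= s /\ 0 <= m s].
have infA : has_inf A by split; [exists t|exists 0 => s []].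
have A0 : 0 <= inf A by apply: lb_le_inf => [|s []//]; exists t.
have mA : m (inf A) < 0.
  apply: mlt => // s /andP[s0 sA]; rewrite ltNge; apply/negP => ms.
  by move: sA; rewrite ltNge => /negP; apply; apply: ge_inf => //; case: infA.
have : \forall s \near inf A, m s < 0.
  exact: (cvgr_lt _ (mc _ A0) _ mA).
move=> /nbhs_ballP[e /= e0 He].
have [s [s0 ms] sA] := inf_adherent e0 infA.
have As : inf A <= s by apply: ge_inf => //; case: infA.
have /He /= : ball (inf A) e s.
  by rewrite -ball_normE /ball_ /= distrC ger0_norm ?subr_ge0// ltrBlDl.
by rewrite ltNge ms.
Qed.

(** As the potential term is nonnegative, the square of each single velocity coordinate is at most
    the energy. *)
Lemma energy_speed_le (R : realType) n (U : 'rV[R]_n -> R) (x v : 'rV[R]_n)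
    (e : R) : 0 <= U x -> 0 <= e -> energy U x v <= e ^+ 2 -> `|v| <= e.
Proof.
move=> U0 e0 E; apply: mx_norm_le => // j i; rewrite ord1.
rewrite -(ler_sqr (x := `|_|)) ?nnegrE// real_normK ?num_real//.
apply: le_trans E; rewrite /energy (bigD1 i)//= -addrA lerDl addr_ge0//.
  by apply: sumr_ge0 => k _; exact: sqr_ge0.
by rewrite mulr_ge0.
Qed.

(* The force is frozen outside a ball growing faster than any trajectory of
   the given energy can move, so the truncation is never felt. *)
Lemma newton_global_solution (R : realType) n (U : 'rV[R]_n -> R)
    (x0 v0 : 'rV[R]_n) :
  class_C 2 U -> (forall x, 0 <= U x) ->
  exists x v : R -> 'rV[R]_n, [/\ x 0 = x0, v 0 = v0 &
    forall t : R, 0 <= t ->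
      is_derive t 1 x (v t) /\ is_derive t 1 v (- gradient U (x t))].
Proof.
move=> CU U0; have dU : forall x, differentiable U x by case: CU.
have E0 : 0 <= energy U x0 v0.
  rewrite addr_ge0 ?mulr_ge0//; apply: sumr_ge0 => i _; exact: sqr_ge0.
(* A speed bound without square roots: [kap ^ 2] exceeds the energy. The extra 1 in the radius [r]
   keeps the trajectory strictly inside. *)
pose kap := 1 + energy U x0 v0.
have kap0 : 0 <= kap by rewrite addr_ge0.
pose r (t : R) := `|x0| + 1 + kap * t.
have rc : continuous r.
  move=> t; apply: cvgD; first exact: cvg_cst.
  by apply: cvgM; [exact: cvg_cst|exact: cvg_id].
have r0 t : 0 <= t -> 0 <= r t by move=> t0; rewrite addr_ge0 ?mulr_ge0// addr_ge0.
have [|T|x [v [x_0 v_0 sol]]] := @second_order_global_solution R n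
  (fun t y => - gradient U (clip (r t) y)) x0 v0.
- move=> y cy t; apply: cvgN.
  apply: (@continuous_comp _ _ _ (fun t => clip (r t) (y t)) (gradient U)).
    exact: clip_continuous.
  exact: gradient_continuous.
(* For [t <= T] the clipped points all lie in the ball of radius [r T], so a single Lipschitz
   constant of the gradient serves on [[0, T]]. *)
- have [L L0 HL] := gradient_lipschitz_on_ball (r T) CU.
  exists L => t /andP[t0 tT] y z; rewrite -opprD normrN.
  have rT (q : 'rV[R]_n) : `|clip (r t) q| <= r T.
    by apply: le_trans (clip_norm _ (r0 t t0)) _; rewrite lerD2l ler_wpM2l.
  by apply: le_trans (HL _ _ (rT y) (rT z)) _; rewrite ler_wpM2l// clip_lipschitz.
have dx (s : R) (s0 : 0 <= s) := (sol s s0).1.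
have dv (s : R) (s0 : 0 <= s) := (sol s s0).2.
(* As long as the trajectory has stayed in the moving ball, the force is the true one, energy is
   conserved, the speed is at most [kap], and the position has moved by at most [kap * t]. *)
have inside : forall t, 0 <= t -> `|x t| - r t < 0.
  apply: first_exit => [t t0|t t0 IH].
    apply: cvgB; last exact: rc.
    by apply: cvg_norm; exact: is_derive_continuous (dx t t0).
  have vk (s : R) : 0 <= s <= t -> `|v s| <= kap.
    move=> /andP[s0 st]; apply: (@energy_speed_le _ _ U (x s)) => //.
    rewrite (energy_conserved s0 dU dx dv).
      by rewrite x_0 v_0 /kap; have := sqr_ge0 (energy U x0 v0); lra.
    move=> q /andP[q0 qs]; rewrite clip_id//; apply/ltW.
    by rewrite -subr_lt0; apply: IH; rewrite q0 (lt_le_trans qs).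
  have : `|x t - x 0| <= kap * t.
    apply: mx_norm_le => [|j i]; first exact: mulr_ge0.
    rewrite ord1 !mxE.
    have := @derive_norm_le R (fun s => x s 0 i) (fun s => v s 0 i)
      (fun s => kap * s) (fun=> kap) 0 t t0.
    rewrite mulr0 subr0; apply.
    - by move=> s /andP[s0 _]; exact: is_derive_entry (dx s s0) i.
    - move=> s _; have := is_deriveZ kap (is_derive_id s (1 : R)).
      by rewrite [_ *: 1]mulr1.
    - by move=> s st; apply: le_trans (vk s st); exact: mx_entry_le.
  have := ler_normD (x t - x 0) (x 0); rewrite subrK x_0 /r; lra.
exists x, v; split=> // t t0; split; first exact: dx.
have := dv t t0; rewrite clip_id//.
by rewrite -subr_le0; apply/ltW/inside.
Qed.

(** * Tangential momentum and drift *)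

Lemma gradient_comp (R : realType) n (f : 'rV[R]_n -> R) (g : R -> R)
    (x : 'rV[R]_n) (i : 'I_n) :
  differentiable f x -> differentiable g (f x) ->
  gradient (g \o f) x 0 i = 'D_(delta_mx 0 i) f x * 'D_1 g (f x).
Proof. by move=> df dg; rewrite mxE derive_comp_scalar. Qed.

Lemma derive_row_norm_le (R : realType) n (u : 'rV[R]_n -> R)
    (x v : 'rV[R]_n) (K e : R) :
  differentiable u x -> \sum_k `|'D_(delta_mx 0 k) u x| <= K -> `|v| <= e ->
  `|'D_v u x| <= K * e.
Proof.
move=> du uK ve; have e0 : 0 <= e := le_trans (normr_ge0 v) ve.
rewrite derive_rowE//; apply: le_trans (ler_norm_sum _ _ _) _.
apply: (@le_trans _ _ ((\sum_k `|'D_(delta_mx 0 k) u x|) * e)); last exact: ler_wpM2r.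
rewrite mulr_suml; apply: ler_sum => k _; rewrite normrM mulrC ler_wpM2l//.
by apply: le_trans ve; exact: mx_entry_le.
Qed.

(* The force is normal to the level sets of [f], so it drops out here. *)
Lemma tangential_momentum_is_derive (R : realType) n (f : 'rV[R]_n -> R)
    (g : R -> R) (i j : 'I_n) (x v : R -> 'rV[R]_n) (t : R) :
  class_C 2 f -> class_C 2 g ->
  is_derive t 1 x (v t) -> is_derive t 1 v (- gradient (g \o f) (x t)) ->
  is_derive t 1
    (fun s => 'D_(delta_mx 0 i) f (x s) * v s 0 j
            - 'D_(delta_mx 0 j) f (x s) * v s 0 i)
    ('D_(v t) ('D_(delta_mx 0 i) f) (x t) * v t 0 j
   - 'D_(v t) ('D_(delta_mx 0 j) f) (x t) * v t 0 i).
Proof.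
move=> [df D1f] [dg _] dx dv.
have d k : differentiable ('D_(delta_mx 0 k) f) (x t) by case: (D1f (delta_mx 0 k)).
have da := is_derive_comp_diff dx (d i).
have db := is_derive_comp_diff dx (d j).
have dm := is_deriveB (is_deriveM da (is_derive_entry dv j))
                      (is_deriveM db (is_derive_entry dv i)).
apply: (is_derive_eq dm).
have force k : (- gradient (g \o f) (x t)) 0 k =
    - ('D_(delta_mx 0 k) f (x t) * 'D_1 g (f (x t))).
  by rewrite mxE gradient_comp.
rewrite !force /GRing.scale /=.
move: ('D_(v t) _ _) ('D_(v t) _ _) ('D_1 g _) ('D_(delta_mx 0 i) f _)
  ('D_(delta_mx 0 j) f _) (v t 0 i) (v t 0 j) => *; ring.
Qed.

(* Over a time of order [1 / e] the tangential momentum, of size [e], changes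
   by [O(e ^ 2)] per unit of time: the distance covered does not depend on [e]. *)
Lemma tangential_drift (R : realType) n (a b : 'rV[R]_n -> R)
    (i j : 'I_n) (p : 'rV[R]_n) (x v : R -> 'rV[R]_n) (K e : R) :
  let C := 2 * `|a p| * K + 1 in
  0 <= K -> 0 < e ->
  (forall y, differentiable a y) -> (forall y, differentiable b y) ->
  x 0 = p -> v 0 0 j = e -> v 0 0 i = 0 ->
  (forall t : R, 0 <= t -> is_derive t 1 x (v t)) ->
  (forall t : R, 0 <= t ->
    is_derive t 1 (fun s => a (x s) * v s 0 j - b (x s) * v s 0 i)
      ('D_(v t) a (x t) * v t 0 j - 'D_(v t) b (x t) * v t 0 i)) ->
  (forall t, 0 <= t -> `|v t| <= e) ->
  (forall t, 0 <= t ->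
    [/\ `|a p| * `|a (x t) - a p| <= a p ^+ 2 / 8,
        `|a p| * `|b (x t) - b p| <= a p ^+ 2 / 8,
        \sum_k `|'D_(delta_mx 0 k) a (x t)| <= K &
        \sum_k `|'D_(delta_mx 0 k) b (x t)| <= K]) ->
  exists2 t, 0 <= t & a p ^+ 4 / (8 * C) <=
    a p * (a p * (x t 0 j - p 0 j) - b p * (x t 0 i - p 0 i)).
Proof.
move=> C K0 e0 da db x0 vj vi dx dW ve near_p.
set al := a p; set be := b p; set c := al ^+ 2.
have c0 : 0 <= c by exact: sqr_ge0.
have C0 : 0 < C by rewrite ltr_wpDl// !mulr_ge0.
have vk k t : 0 <= t -> `|v t 0 k| <= e.
  by move=> t0; apply: le_trans (ve t t0); exact: mx_entry_le.
pose W s := a (x s) * v s 0 j - b (x s) * v s 0 i.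
pose W' s := 'D_(v s) a (x s) * v s 0 j - 'D_(v s) b (x s) * v s 0 i.
have W0 : W 0 = al * e by rewrite /W x0 vj vi mulr0 subr0.
(* Each of the two terms of [W'] is at most [K * e ^ 2]. The summand 1 in [C] only ensures that [C]
   is positive. *)
have W'le s : 0 <= s -> `|al * W' s| <= C * e ^+ 2.
  move=> s0; have [_ _ aK bK] := near_p s s0.
  have h1 := derive_row_norm_le (da (x s)) aK (ve s s0).
  have h2 := derive_row_norm_le (db (x s)) bK (ve s s0).
  have h3 := ler_pM (normr_ge0 _) (normr_ge0 _) h1 (vk j s s0).
  have h4 := ler_pM (normr_ge0 _) (normr_ge0 _) h2 (vk i s s0).
  have h5 : `|W' s| <= K * e * e + K * e * e.
    apply: le_trans (ler_normB _ _) _.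
    by rewrite !normrM; exact: lerD h3 h4.
  rewrite normrM; apply: le_trans (ler_wpM2l (normr_ge0 _) h5) _.
  rewrite /C -/al; have := sqr_ge0 e.
  by clear; move: `|al| => A; lra.
have Wge t : 0 <= t -> c * e - C * e ^+ 2 * t <= al * W t.
  move=> t0; have := @derive_norm_le R (fun s => al * W s) (fun s => al * W' s)
    (fun s => C * e ^+ 2 * s) (fun=> C * e ^+ 2) 0 t t0.
  rewrite mulr0 subr0 W0 mulrA -expr2 -/c => H.
  suff : `|al * W t - c * e| <= C * e ^+ 2 * t.
    by rewrite ler_norml => /andP[+ _]; rewrite lerBrDr addrC.
  apply: H => s /andP[s0 _].
  - exact: is_deriveZ (dW s s0).
  - have := is_deriveZ (C * e ^+ 2) (is_derive_id s (1 : R)).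
    by rewrite [_ *: 1]mulr1.
  - exact: W'le.
(* The time at which the lower bound [c * e - C * e ^ 2 * t] for [al * W t] has dropped to half its
   initial value. *)
pose T := c / (2 * C * e).
have T0 : 0 <= T by rewrite divr_ge0// !mulr_ge0// ltW.
have TE : C * e ^+ 2 * T = c * e / 2.
  by rewrite /T; field; rewrite !gt_eqF.
exists T => //.
(* The displacement along the tangent vector at [p], scaled by [al], is compared with uniform motion
   at rate [c * e / 4]. Up to [T], [al * W] is at least [c * e / 2], and freezing the two
   coefficients at [p] costs at most [c * e / 8] each. *)
pose y s := al * (al * (x s 0 j - p 0 j) - be * (x s 0 i - p 0 i)) - c * e / 4 * s.
have dy (s : R) : 0 <= s ->
    is_derive s 1 y (al * (al * v s 0 j - be * v s 0 i) - c * e / 4).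
  move=> s0.
  have d k : is_derive s 1 (fun s => x s 0 k - p 0 k) (v s 0 k).
    have := is_deriveB (is_derive_entry (dx s s0) k) (is_derive_cst (p 0 k) s 1).
    by rewrite subr0.
  have dl := is_deriveZ (c * e / 4) (is_derive_id s (1 : R)).
  have dl' := is_deriveZ al (is_deriveB (is_deriveZ al (d j)) (is_deriveZ be (d i))).
  have := is_deriveB dl' dl.
  by rewrite [_ *: 1]mulr1.
have : y 0 <= y T.
  apply: (derive_ge0_le T0 (f' := fun s => al * (al * v s 0 j - be * v s 0 i) - c * e / 4)).
  - apply: continuous_in_subspaceT => s; rewrite inE /= in_itv /= => /andP[s0 _].
    exact: is_derive_continuous (dy s s0).
  - by move=> s /andP[s0 _]; apply: dy; exact: ltW.
  - move=> s /andP[/ltW s0 sT].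
    have [ha hb _ _] := near_p s s0; rewrite -/al -/be -/c in ha hb.
    have h1 : `|al * (a (x s) - al) * v s 0 j| <= c / 8 * e.
      by rewrite !normrM; apply: ler_pM; rewrite ?mulr_ge0// vk.
    have h2 : `|al * (b (x s) - be) * v s 0 i| <= c / 8 * e.
      by rewrite !normrM; apply: ler_pM; rewrite ?mulr_ge0// vk.
    have h3 := Wge s s0.
    have h4 : C * e ^+ 2 * s <= c * e / 2.
      by rewrite -TE ler_wpM2l ?(ltW sT)// mulr_ge0 ?sqr_ge0// ltW.
    have split_error (A B w u q r : R) : A * (A * r - B * q) =
      A * (w * r - u * q) - A * (w - A) * r + A * (u - B) * q by ring.
    rewrite (split_error al be (a (x s)) (b (x s))) -/(W s).
    move: h1 h2; rewrite !ler_norml => /andP[_ h1] /andP[h2 _].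
    move: (al * W s) (_ * v s 0 j) (_ * v s 0 i) (C * _ * _) h1 h2 h3 h4 => *; lra.
(* Here [e] cancels: the rate is proportional to [e] and the duration to its inverse. *)
have cT : c * e / 4 * T = al ^+ 4 / (8 * C).
  by rewrite /T /c; field; rewrite !gt_eqF.
rewrite /y x0 !subrr !mulr0 subrr mulr0 subr0 cT; lra.
Qed.

(** * Equilibrium and instability on the zero set *)

Theorem mainTheorem1 (R : realType) (n : nat) (f : 'rV[R]_n -> R) (g : R -> R)
    (hn : (2 <= n)%N)
    (hf : class_C 3 f)
    (hreg : regular_value f 0)
    (hg : class_C 2 g)
    (hg_ge0 : forall s : R, 0 <= g s)
    (hg_eq0 : forall s : R, g s = 0 <-> s = 0) :
  let U := g \o f in
  let M := [set x : 'rV[R]_n | f x = 0] in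
  M = [set x : 'rV[R]_n | U x = 0] /\
  forall p : 'rV[R]_n, M p ->
    equilibrium (newton_field U) (p, 0) /\
    lyapunov_unstable (newton_field U) (p, 0).
Proof.
move=> U M.
have Cf : class_C 2 f := class_CS hf.
have CU : class_C 2 U by exact: class_C2_comp.
have [df D1f] := Cf; have [dg _] := hg.
have UE x : U x = 0 <-> f x = 0 by exact: hg_eq0.
split; first by apply/seteqP; split => x /=; rewrite UE.
move=> p Mp; split.
  rewrite /equilibrium /newton_field /=; congr (_, _).
  apply/rowP => i; rewrite mxE gradient_comp// Mp.
  (* The point 0 is an interior minimum of [g] on []-1, 1[]. *)
  have -> : 'D_1 g 0 = 0.
    have g0 : is_derive (0 : R) 1 g 0.
      apply: (@derive1_at_min R g (-1) 1 0).
      - lra.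
      - by move=> t _; exact/derivable1_diffP.
      - by rewrite in_itv /= ltrN10 ltr01.
      - by move=> t _; rewrite (hg_eq0 0).2.
    exact: derive_val.
  by rewrite mulr0 oppr0 mxE.
(* If all partial derivatives vanished at [p], the differential would be zero and could not take the
   value 1. *)
have [i ip] : exists i, 'D_(delta_mx 0 i) f p != 0.
  apply: contrapT => /forallNP D0.
  have [v _ /eqP] := hreg p Mp 1 I.
  rewrite -deriveE// derive_rowE// big1 => [|k _]; first by rewrite eq_sym oner_eq0.
  by have /negP := D0 k; rewrite negbK => /eqP ->; rewrite scaler0.
(* One of the indices 0 and 1 differs from [i]; both exist because [n >= 2]. *)
have [j ji] : exists j : 'I_n, j != i.
  have [i0|i0] := eqVneq (nat_of_ord i) 0%N.
    by exists (Ordinal hn); rewrite -val_eqE /= i0.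
  by exists (Ordinal (ltnW hn)); rewrite -val_eqE /= eq_sym.
pose a := 'D_(delta_mx 0 i) f; pose b := 'D_(delta_mx 0 j) f.
have Ca : class_C 1 a := D1f _; have Cb : class_C 1 b := D1f _.
have dW x v (t : R) : is_derive t 1 x (v t) ->
    is_derive t 1 v (- gradient U (x t)) ->
    is_derive t 1 (fun s => a (x s) * v s 0 j - b (x s) * v s 0 i)
      ('D_(v t) a (x t) * v t 0 j - 'D_(v t) b (x t) * v t 0 i).
  exact: tangential_momentum_is_derive.
have ap0 : a p != 0 := ip.
clearbody a b.
pose Da x := \sum_k `|'D_(delta_mx 0 k) a x|.
pose Db x := \sum_k `|'D_(delta_mx 0 k) b x|.
(* The extra 1 leaves room for [Da] and [Db] to stay below [K] throughout a neighborhood of [p]. *)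
pose K := Da p + Db p + 1.
have Da0 : 0 <= Da p by apply: sumr_ge0 => k _; exact: normr_ge0.
have Db0 : 0 <= Db p by apply: sumr_ge0 => k _; exact: normr_ge0.
have K0 : 0 <= K by rewrite !addr_ge0.
have ap2 : 0 < a p ^+ 2 / 8 by rewrite divr_gt0// exprn_even_gt0.
have sumc u : class_C 1 u -> continuous (fun x : 'rV[R]_n => \sum_k `|'D_(delta_mx 0 k) u x|).
  move=> [_ cu]; apply: continuous_big => [|k _ x].
    by move=> y; exact: add_continuous.
  exact: cvg_norm (cu (delta_mx 0 k) x).
have near_p : \forall x \near p,
    [/\ `|a p| * `|a x - a p| <= a p ^+ 2 / 8,
        `|a p| * `|b x - b p| <= a p ^+ 2 / 8, Da x <= K & Db x <= K].
  have close u : class_C 1 u ->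
      \forall x \near p, `|a p| * `|u x - u p| <= a p ^+ 2 / 8.
    move=> /class_CS cu; near=> x.
    rewrite -ler_pdivlMl ?normr_gt0// distrC; near: x.
    apply: ((cvgrPdist_le _ _).1 (cu p)).
    by rewrite mulr_gt0// invr_gt0 normr_gt0.
  near=> x; split; near: x; [exact: close Ca|exact: close Cb| |].
  - by apply: (cvgr_le (Da p)); [exact: sumc|rewrite /K; lra].
  - by apply: (cvgr_le (Db p)); [exact: sumc|rewrite /K; lra].
move/nbhs_ballP : near_p => [d0 /= d0_gt0 Hd0].
set C := 2 * `|a p| * K + 1.
have C0 : 0 < C by rewrite ltr_wpDl// !mulr_ge0.
set D := a p ^+ 4 / (8 * C).
have D0 : 0 < D by apply: divr_gt0; [rewrite exprn_even_gt0|exact: mulr_gt0].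
(* If both coordinates stay within [d] of [p], the scaled displacement is less than [m * d]. Taking
   [d <= D / m] makes this incompatible with a drift of at least [D], and [d <= d0] keeps the
   estimates near [p] valid. Neither depends on the initial speed. *)
pose m := `|a p| * (`|a p| + `|b p|) + 1.
have m0 : 0 < m by rewrite ltr_wpDl// mulr_ge0// addr_ge0.
pose d := Num.min d0 (D / m).
have d_gt0 : 0 < d by rewrite lt_min d0_gt0 divr_gt0.
move=> stable.
have [N' /nbhs_ballP[e /= e0 HN'] stay] := stable (ball (p, 0) d) (nbhsx_ballx _ _ d_gt0).
(* Half of the stability radius, so that the initial state with speed [ep] lies in the open ball of
   radius [e]. *)
pose ep := e / 2; have ep0 : 0 < ep by rewrite divr_gt0.
pose v0 : 'rV[R]_n := ep *: delta_mx 0 j.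
have [x [v [x0 v00 sol]]] := newton_global_solution p v0 CU (fun x => hg_ge0 (f x)).
have v0E k : v0 0 k = if k == j then ep else 0.
  by rewrite !mxE eqxx /=; case: eqP => _; rewrite ?mulr1 ?mulr0.
have xv_near t : 0 <= t -> ball p d (x t).
  move=> t0; have := stay (fun s => (x s, v s)) _ _ t t0; case=> //.
    by move=> s s0; have [] := sol s s0; exact: is_derive_pair.
  apply: HN'; rewrite x0 v00; split; first exact: ballxx.
  rewrite -ball_normE /ball_ /= sub0r normrN.
  apply: (@le_lt_trans _ _ ep); last by rewrite /ep; lra.
  apply: mx_norm_le => [|k' k]; first exact: ltW.
  by rewrite ord1 v0E; case: ifP => _; [rewrite gtr0_norm|rewrite normr0 ltW].
(* The potential vanishes at [p], so the energy is purely kinetic and bounds the speed by [ep]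
   forever. *)
have E0 : energy U p v0 = ep ^+ 2.
  rewrite /energy (UE p).2// mulr0 addr0 (bigD1 j)//= v0E eqxx big1 ?addr0//.
  by move=> k /negPf kj; rewrite v0E kj expr0n.
have speed t : 0 <= t -> `|v t| <= ep.
  move=> t0; apply: (@energy_speed_le _ _ U (x t)); [exact: hg_ge0|exact: ltW|].
  have dx (s : R) (s0 : 0 <= s) := (sol s s0).1.
  have dv (s : R) (s0 : 0 <= s) := (sol s s0).2.
  rewrite (energy_conserved (w := fun s => - gradient U (x s)) t0 CU.1 dx dv)//.
  by rewrite x0 v00 E0.
have vj : v 0 0 j = ep by rewrite v00 v0E eqxx.
have vi : v 0 0 i = 0 by rewrite v00 v0E eq_sym (negPf ji).
have dd0 : d <= d0 by rewrite /d ge_min lexx.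
have near_x t (t0 : 0 <= t) := Hd0 (x t) (le_ball dd0 (xv_near t t0)).
have da y : differentiable a y := Ca.1 y.
have db y : differentiable b y := Cb.1 y.
have [t t0] := tangential_drift K0 ep0 da db x0 vj vi (fun s h => (sol s h).1)
  (fun s h => dW x v s (sol s h).1 (sol s h).2) speed near_x.
rewrite -/C -/D; apply/negP; rewrite -ltNge.
have xk k : `|x t 0 k - p 0 k| <= d.
  have := xv_near t t0; rewrite -ball_normE /ball_ /= distrC => /ltW.
  by apply: le_trans; have := mx_entry_le (x t - p) 0 k; rewrite !mxE.
(* The confinement to the ball of radius [d] bounds the displacement strictly below [D], which
   contradicts the drift. *)
apply: (@le_lt_trans _ _ (`|a p| * (`|a p| * d + `|b p| * d))).
  apply: le_trans (ler_norm _) _; rewrite normrM ler_wpM2l//.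
  apply: le_trans (ler_normB _ _) _.
  by rewrite !normrM lerD// ler_wpM2l.
rewrite -mulrDl mulrA; apply: (@lt_le_trans _ _ (m * d)).
  by rewrite ltr_pM2r// /m ltrDl.
by rewrite mulrC -ler_pdivlMr// /d ge_min lexx orbT.
Unshelve. all: by end_near. Qed.
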